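(* Let $p$ be an odd prime and $k\in\mathbb{N}$ with $2\le k\le \frac{p-1}{2}$ such that $p>2k+1$ and $p\equiv 1\pmod{k}$. If $n\in\{\frac{p-1}{k}+1,\frac{p-1}{k}+2,\ldots,\frac{2(p-1)}{k}-1\}$ satisfies $n\equiv\frac{p-1}{k}\pmod 2$ and $d\in\mathbb{Z}$ satisfies $\chi_k(d)=-1$, then $$S_{n,k}(d,p)\equiv 0\pmod p.$$
   Context: For an odd prime $p$ and an integer $k\ge 2$ with $k\mid p-1$, let $\alpha_1,\ldots,\alpha_{(p-1)/k}$ be integers representing the distinct (nonzero) $k$-th power residues modulo $p$. For $n\in\mathbb{N}$ and $d\in\mathbb{Z}$, $$S_{n,k}(d,p)=\det\left[(\alpha_i+d\,\alpha_j)^n\right]_{1\le i,j\le \frac{p-1}{k}}.$$ $\chi_k$ denotes a multiplicative character of order $k$ modulo $p$; for $\epsilon\in\{1,-1\}$, the condition $\chi_k(d)=\epsilon$ is equivalent to $d^{(p-1)/k}\equiv\epsilon\pmod p$. *)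

(* Defs.v *)
From mathcomp Require Import all_boot all_order all_algebra.
From mathcomp Require Import all_fingroup all_solvable all_field all_character.

Set Implicit Arguments.
Unset Strict Implicit.
Unset Printing Implicit Defensive.

Import GRing.Theory Num.Theory.

Local Open Scope ring_scope.

Definition power_residue (k p : nat) (a : int) : Prop :=
  ~~ (p %| a)%Z /\ exists x : int, (x ^+ k = a %[mod p])%Z.

(* alpha is a full system of pairwise incongruent representatives of the
   nonzero k-th power residues modulo p. *)
Definition represents_power_residues (k p : nat)
    (alpha : 'I_((p - 1) %/ k) -> int) : Prop :=
  [/\ forall i, power_residue k p (alpha i),
      forall i j, (alpha i = alpha j %[mod p])%Z -> i = j
    & forall a, power_residue k p a -> exists i, (a = alpha i %[mod p])%Z].

Definition S_det (n k p : nat) (alpha : 'I_((p - 1) %/ k) -> int) (d : int) :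
    int :=
  \det (\matrix_(i, j) (alpha i + d * alpha j) ^+ n).

(* For p prime, a multiplicative character modulo p is a linear character of
   the group of units of 'F_p; here it is evaluated at an integer, with the
   usual extension by 0 to the multiples of p. *)
Definition char_at (p : nat) (chi : 'CF([set: {unit 'F_p}])) (d : int) : algC :=
  if insub (d%:~R : 'F_p) is Some u then chi u else 0.

(* Main.v *)
Require Import Defs.
From mathcomp Require Import all_boot all_order all_algebra.
From mathcomp Require Import all_fingroup all_solvable all_field all_character.
From mathcomp Require Import zify.

Set Implicit Arguments.
Unset Strict Implicit.
Unset Printing Implicit Defensive.

Import GRing.Theory Num.Theory.

Local Open Scope ring_scope.

(** Write m = (p - 1) / k, so that d ^ m = -1 and n = m + 2t with 0 < t and
    2t < m. The k-th power residues b_i form the group of m-th roots of unity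
    of F_p, whose e-th power sum vanishes unless m divides e. Expanding
    (b_i + d b_j) ^ n and pairing row i with the weight b_i ^ (m - t), only the
    terms of degrees t and t + m in d survive. Their binomial coefficients
    agree because t + (t + m) = n, and d ^ (t + m) = - d ^ t, so they cancel:
    these weights are a linear dependency between the rows. *)

(** Multiplication by [w] permutes the finite family [b], so the power sum equals [w ^+ e] times
    itself. *)
Lemma power_sum_stable_eq0 (F : fieldType) (I : finType) (b : I -> F) (w : F)
    (e : nat) :
  injective b -> (forall i, exists j, b j = w * b i) -> w != 0 ->
  w ^+ e != 1 -> \sum_i b i ^+ e = 0.
Proof.
move=> b_inj /fin_all_exists[h hP] w_neq0 we_neq1.
have h_inj : injective h.
  by move=> i j hij; apply/b_inj/(mulfI w_neq0); rewrite -!hP hij.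
have sumE : \sum_i b i ^+ e = w ^+ e * \sum_i b i ^+ e.
  rewrite {1}(reindex_inj h_inj) mulr_sumr.
  by apply: eq_bigr => i _; rewrite hP exprMn.
have /eqP : (1 - w ^+ e) * \sum_i b i ^+ e = 0.
  by rewrite mulrBl mul1r -sumE subrr.
by rewrite mulf_eq0 subr_eq0 eq_sym (negbTE we_neq1) => /eqP.
Qed.

Lemma det_binomial_eq0 (F : fieldType) (m t : nat) (b : 'I_m -> F) (d : F) :
  (forall i, b i ^+ m = 1) ->
  (forall e, ~~ (m %| e)%N -> \sum_i b i ^+ e = 0) ->
  d ^+ m = -1 -> (2 * t < m)%N ->
  \det (\matrix_(i, j) (b i + d * b j) ^+ (m + 2 * t)) = 0.
Proof.
move=> b_m b_sum d_m t_lt; apply/eqP/det0P.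
have m_gt0 : (0 < m)%N by lia.
(* With this weight the term of degree [s] in [d] carries [b i] to the exponent [2m + t - s], which
   is a multiple of [m] exactly when [s] is congruent to [t] modulo [m]. *)
exists (\row_i b i ^+ (m - t)).
  apply/eqP => /rowP/(_ (Ordinal m_gt0)); rewrite !mxE => /eqP.
  rewrite expf_eq0 => /andP[_ /eqP b0].
  by have /eqP := b_m (Ordinal m_gt0); rewrite b0 expr0n gtn_eqF // eq_sym oner_eq0.
apply/rowP => j; rewrite !mxE.
set n := (m + 2 * t)%N.
pose f s := (\sum_i b i ^+ (m - t + (n - s))) * (d * b j) ^+ s *+ 'C(n, s).
transitivity (\sum_(s < n.+1) f s).
  transitivity (\sum_i \sum_(s < n.+1)
      b i ^+ (m - t + (n - s)) * (d * b j) ^+ s *+ 'C(n, s)).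
    apply: eq_bigr => i _; rewrite !mxE exprDn mulr_sumr.
    by apply: eq_bigr => s _; rewrite mulrnAr mulrA exprD.
  rewrite exchange_big; apply: eq_bigr => s _.
  by rewrite /f mulr_suml -sumrMnl.
have t_lt_n : (t < n.+1)%N by lia.
have tm_lt_n : (t + m < n.+1)%N by lia.
have ord_neq : Ordinal tm_lt_n != Ordinal t_lt_n by rewrite -val_eqE /=; lia.
rewrite (bigD1 (Ordinal t_lt_n)) //= (bigD1 (Ordinal tm_lt_n)) //=.
rewrite big1 => [|s /andP[s_neq_t s_neq_tm]]; last first.
  (* The exponent lies between [m - t > 0] and [2m + t < 3m], so a multiple [q * m] forces [q = 2],
     i.e. [s = t], or [q = 1], i.e. [s = t + m]. *)
  rewrite /f b_sum ?mul0r ?mul0rn //; apply/negP => /dvdnP[q].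
  move: s_neq_t s_neq_tm (ltn_ord s); rewrite -!val_eqE /= /n.
  move=> s_neq_t s_neq_tm s_lt qE.
  have : (q == 1)%N || (q == 2)%N by apply/orP; nia.
  by case/orP => /eqP q12; rewrite q12 in qE; lia.
have b_mM i q : b i ^+ (q * m) = 1 by rewrite mulnC exprM b_m expr1n.
have powE s q : (m - t + (n - s) = q * m)%N -> \sum_i b i ^+ (m - t + (n - s)) = m%:R.
  move=> ->; rewrite (eq_bigr (fun=> 1)) => [|i _]; last exact: b_mM.
  by rewrite sumr_const card_ord.
rewrite /f (powE t 2%N) ?(powE (t + m)%N 1%N); [|lia|lia].
have -> : 'C(n, t) = 'C(n, t + m).
  by rewrite -bin_sub; [congr 'C(_, _); lia | lia].
by rewrite !exprMn !exprD d_m b_m mulrN1 mulr1 mulNr mulrN addr0 mulNrn subrr.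
Qed.

Lemma unit_group_generator (F : finFieldType) :
  exists g : {unit F}, [set: {unit F}] = <[g]>%g /\ #[g]%g = #|F|.-1.
Proof.
have /cyclicP[g gE] : cyclic [set: {unit F}] := field_unit_group_cyclic _.
by exists g; split; rewrite // orderE -gE card_finField_unit.
Qed.

(** Write [u = g ^+ e] for a generator [g]. Since [chi g] has order exactly [k], the value -1 means
    that [k] divides [2e] but not [e]. As [g] has order [m * k], the power [u ^+ m] differs from 1
    while its square is 1. *)
Lemma lin_char_eqN1 (F : finFieldType) (chi : 'CF([set: {unit F}]))
    (u : {unit F}) (m k : nat) :
  chi \is a linear_char -> #[chi]%CF = k -> (m * k)%N = #|F|.-1 ->
  chi u = -1 -> val u ^+ m = -1.
Proof.
move=> chi_lin chi_k mk chi_u.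
have [g [gE g_ord]] := unit_group_generator F.
have in_g x : exists i, x = (g ^+ i)%g by apply/cycleP; rewrite -gE inE.
have F_gt1 : (0 < #|F|.-1)%N by rewrite -g_ord order_gt0.
have m_gt0 : (0 < m)%N by move: F_gt1; rewrite -mk muln_gt0 => /andP[].
(* A linear character is determined by its value at the generator. *)
have chi_g e : (chi g ^+ e == 1) = (k %| e)%N.
  rewrite -chi_k dvdn_cforder; apply/eqP/eqP => [ge1|chie1]; last first.
    by rewrite -exp_cfunE ?inE // chie1 cfun1E inE.
  apply/cfun_inP => x _; have [i ->] := in_g x.
  by rewrite exp_cfunE ?inE // lin_charX ?inE // exprAC ge1 expr1n cfun1E inE.
have [e uE] := in_g u.
have chi_e : chi g ^+ e = -1 by rewrite -lin_charX ?inE // -uE.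
have k_e : ~~ (k %| e)%N by rewrite -chi_g chi_e eqNr oner_eq0.
have k_2e : (k %| e * 2)%N by rewrite -chi_g exprM chi_e sqrrN expr1n.
have um_neq1 : val u ^+ m != 1.
  rewrite -FinRing.val_unitX -FinRing.val_unit1 val_eqE uE -expgM -order_dvdn.
  by rewrite g_ord -mk mulnC dvdn_pmul2r.
have : (val u ^+ m) ^+ 2 == 1.
  rewrite -!FinRing.val_unitX -FinRing.val_unit1 val_eqE uE -!expgM -?mulnA -order_dvdn.
  by rewrite g_ord -mk mulnCA dvdn_pmul2l.
by rewrite sqrf_eq1 (negbTE um_neq1) => /eqP.
Qed.

Lemma char_at_eqN1 (p k m : nat) (chi : 'CF([set: {unit 'F_p}])) (d : int) :
  prime p -> chi \is a linear_char -> #[chi]%CF = k -> (m * k)%N = p.-1 ->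
  char_at chi d = -1 -> (d%:~R : 'F_p) ^+ m = -1.
Proof.
move=> p_pr chi_lin chi_k mk; rewrite /char_at.
(* If [d] is not a unit, [char_at] takes its default value 0, which is not -1. *)
case: insubP => [u _ <- chi_u|_ /eqP]; last by rewrite eq_sym oppr_eq0 oner_eq0.
by apply: (lin_char_eqN1 chi_lin chi_k _ chi_u); rewrite card_Fp.
Qed.

Lemma intr_Fp_eq (p : nat) (a b : int) : prime p ->
  (a = b %[mod p])%Z <-> a%:~R = b%:~R :> 'F_p.
Proof.
move=> p_pr; have pchar := pchar_Fp p_pr; split=> /eqP.
  by rewrite eqz_mod_dvd (dvdz_pcharf pchar) rmorphB subr_eq0 => /eqP.
by rewrite -subr_eq0 -rmorphB -(dvdz_pcharf pchar) -eqz_mod_dvd => /eqP.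
Qed.

Lemma intr_Fp_val (p : nat) (x : 'F_p) : (x : nat)%:Z%:~R = x.
Proof. by rewrite -pmulrn natr_Zp. Qed.

Lemma power_residue_Fp (p k : nat) (a : int) : prime p ->
  power_residue k p a <->
  (a%:~R : 'F_p) != 0 /\ exists x : 'F_p, x ^+ k = a%:~R.
Proof.
move=> p_pr; rewrite /power_residue (dvdz_pcharf (pchar_Fp p_pr)).
split=> -[a_neq0 [x xE]]; split=> //.
  by exists x%:~R; move/(intr_Fp_eq _ _ p_pr): xE; rewrite rmorphXn.
exists (x : nat)%:Z; apply/(intr_Fp_eq _ _ p_pr).
by rewrite rmorphXn /= intr_Fp_val.
Qed.

Lemma power_residue_sum_eq0 (p k m : nat) (alpha : 'I_((p - 1) %/ k) -> int)
    (e : nat) :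
  prime p -> (m * k)%N = p.-1 -> represents_power_residues alpha ->
  ~~ (m %| e)%N -> \sum_i ((alpha i)%:~R : 'F_p) ^+ e = 0.
Proof.
move=> p_pr mk [alpha_res alpha_inj alpha_surj] m_e.
have [g [_ g_ord]] := unit_group_generator 'F_p.
rewrite card_Fp // in g_ord.
have g_neq0 : val g != 0 by rewrite -unitfE (valP g).
have k_gt0 : (0 < k)%N.
  by have := order_gt0 g; rewrite g_ord -mk muln_gt0 => /andP[].
(* The [k]-th power of a generator maps residues to residues, and its order is exactly [m]. *)
apply: (@power_sum_stable_eq0 _ _ _ (val g ^+ k)).
- by move=> i j /(intr_Fp_eq _ _ p_pr)/alpha_inj.
- move=> i; have /(power_residue_Fp _ _ p_pr)[a_neq0 [x xE]] := alpha_res i.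
  (* The product is lifted to an integer [c] because [alpha_surj] speaks of integer residues. *)
  pose y : 'F_p := val g ^+ k * (alpha i)%:~R; pose c := (y : nat)%:Z.
  have cE : c%:~R = y := intr_Fp_val y.
  have [|j /(intr_Fp_eq _ _ p_pr) cj] := alpha_surj c.
    apply/(power_residue_Fp _ _ p_pr); rewrite cE; split.
      by rewrite mulf_neq0 // expf_neq0.
    by exists (val g * x); rewrite exprMn xE.
  by exists j; rewrite -cj.
- exact: expf_neq0.
- rewrite -exprM -FinRing.val_unitX -FinRing.val_unit1 val_eqE -order_dvdn.
  by rewrite g_ord -mk mulnC dvdn_pmul2l.
Qed.

Theorem theorem1p1 (p k n : nat) (d : int)
    (alpha : 'I_((p - 1) %/ k) -> int)
    (chi : 'CF([set: {unit 'F_p}])) :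
  prime p -> odd p ->
  (2 <= k)%N -> (k <= (p - 1) %/ 2)%N ->
  (2 * k + 1 < p)%N ->
  p = 1 %[mod k] ->
  represents_power_residues alpha ->
  chi \is a linear_char -> #[chi]%CF = k ->
  ((p - 1) %/ k + 1 <= n)%N -> (n <= (2 * (p - 1)) %/ k - 1)%N ->
  n = (p - 1) %/ k %[mod 2] ->
  char_at chi d = -1 ->
  (S_det n alpha d = 0 %[mod p])%Z.
Proof.
move=> p_pr _ k_ge2 _ _ p_mod alpha_repr chi_lin chi_k n_ge n_le n_mod chi_d.
have p_gt1 := prime_gt1 p_pr.
have k_dvd : (k %| p - 1)%N by rewrite -eqn_mod_dvd ?p_mod // ltnW.
have mk : ((p - 1) %/ k * k)%N = p.-1 by rewrite divnK // subn1.
rewrite -muln_divA // in n_le.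
(* The parity condition makes [n - (p - 1) %/ k] even, and the upper bound on [n] gives the strict
   inequality. *)
have [t nE t_lt] : exists2 t,
    n = ((p - 1) %/ k + 2 * t)%N & (2 * t < (p - 1) %/ k)%N.
  by exists ((n - (p - 1) %/ k) %/ 2)%N; lia.
apply/(intr_Fp_eq _ _ p_pr); rewrite -det_map_mx.
have -> : map_mx intr (\matrix_(i, j) (alpha i + d * alpha j) ^+ n) =
    \matrix_(i, j) ((alpha i)%:~R + d%:~R * (alpha j)%:~R : 'F_p) ^+ n.
  by apply/matrixP => i j; rewrite !mxE rmorphXn rmorphD rmorphM.
rewrite nE det_binomial_eq0 //.
- move=> i; have [alpha_res _ _] := alpha_repr.
  have /(power_residue_Fp _ _ p_pr)[a_neq0 [x xE]] := alpha_res i.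
  (* The residue is [x ^+ k], so the claim becomes [x ^+ p.-1 = 1]: Fermat's [x ^+ p = x] with the
     nonzero [x] cancelled. *)
  rewrite -xE -exprM mulnC mk; apply: (mulfI (x := x)).
    by apply: contraNneq a_neq0 => x0; rewrite -xE x0 expr0n gtn_eqF // ltnW.
  by rewrite -exprS prednK ?prime_gt0 // mulr1 -[RHS]expf_card card_Fp.
- by move=> e; apply: power_residue_sum_eq0 alpha_repr.
- exact: char_at_eqN1 chi_lin chi_k mk chi_d.
Qed.
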